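(* Let $\rho_1\approx0.456$ be the positive root of $\rho\left(\zeta(2)+\rho\,\zeta(3)\right)=1$, where $\zeta$ is the Riemann zeta function, and let $\rho\in(0,\rho_1)$. Consider the infinite linear system in the unknowns $w_1,w_2,w_3,\ldots$ $$-w_1(1-\rho)+\sum_{j=2}^\infty w_j(-1)^{j-1}\frac{\rho}{j^2}=-1,$$ $$w_i\left(\left(1+\frac{\rho}{i}\right)\frac{(-1)^{i-1}\rho^{i/2-1}}{i^i}-\frac{\rho^{-i/2}}{i}\right)+\sum_{j\ge1,\ j\ne i}w_j(-1)^{j-1}\left(1+\frac{\rho}{j}\right)\frac{\rho^{i/2-1}}{j^i}=0,\qquad i=2,3,\ldots.$$ Then this system has a unique bounded solution $(w_j)_{j\ge1}$. Moreover, for every $N\ge1$ the truncated $N\times N$ system, obtained by keeping only the first $N$ equations and the first $N$ unknowns, has a unique solution $(w_1^N,\ldots,w_N^N)$, and for each fixed $j$ the sequence $(w_j^N)_{N\ge j}$ is Cauchy and converges to $w_j$ as $N\to\infty$.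
   Context: This system arises in the light traffic analysis of the synchronized gated $GI/M/\infty$ queue in the case of Poisson($\lambda$) arrivals, service rate $\mu$ and $\rho=\lambda/\mu$; there $w_i=i\,x_i$, where $x_i$ is the $i$-th stationary factorial moment, divided by $i!$, of the number of customers served in a stage. The statement itself concerns only the displayed linear system. *)

(* Defs.v *)
From HB Require Import structures.
From mathcomp Require Import all_boot all_order all_algebra.
From mathcomp Require Import all_classical all_reals all_analysis.

Set Implicit Arguments.
Unset Strict Implicit.
Unset Printing Implicit Defensive.

Import Order.TTheory GRing.Theory Num.Theory.
Import numFieldNormedType.Exports.

Local Open Scope classical_set_scope.
Local Open Scope ring_scope.

(* Meaningful for s > 1 only, where the series converges; used at s = 2, 3. *)
Definition zeta (R : realType) (s : R) : R := limn (series (riemannR s)).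

Definition is_pos_root (R : realType) (r : R) : Prop :=
  0 < r /\ r * (zeta 2 + r * zeta 3) = 1.

(* coef rho i j is the coefficient of w_j in the i-th equation and rhs i the
   right-hand side of the i-th equation, for i, j >= 1. *)
Definition coef (R : realType) (rho : R) (i j : nat) : R :=
  if i == 1%N then
    if j == 1%N then - (1 - rho)
    else (-1) ^+ j.-1 * (rho / j%:R ^+ 2)
  else
    if j == i then
      (1 + rho / i%:R) * ((-1) ^+ i.-1 * rho `^ (i%:R / 2 - 1) / i%:R ^+ i)
        - rho `^ (- (i%:R / 2)) / i%:R
    else
      (-1) ^+ j.-1 * (1 + rho / j%:R) * (rho `^ (i%:R / 2 - 1) / j%:R ^+ i).

Definition rhs (R : realType) (i : nat) : R := if i == 1%N then -1 else 0.

(* The unknowns are stored from index 0: w k stands for w_(k+1), both for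
   sequences and for the column vectors of the truncated systems. *)
Definition solves_system (R : realType) (rho : R) (w : nat -> R) : Prop :=
  forall i : nat, (1 <= i)%N ->
    series (fun k => coef rho i k.+1 * w k) @ \oo --> rhs R i.

Definition bounded_solution (R : realType) (rho : R) (w : nat -> R) : Prop :=
  bounded_fun w /\ solves_system rho w.

Definition trunc_mx (R : realType) (rho : R) (N : nat) : 'M[R]_N :=
  \matrix_(i, j) coef rho i.+1 j.+1.

Definition trunc_rhs (R : realType) (N : nat) : 'cV[R]_N :=
  \col_i rhs R i.+1.

Definition trunc_solution (R : realType) (rho : R) (N : nat) (v : 'cV[R]_N) :
  Prop := trunc_mx rho N *m v = trunc_rhs R N.

(* The sequence (w_j^N)_{N >= j} for j = k+1, indexed by n = N - j; the entry
   of index lshift n ord_max is the one of value k, that is w_(k+1)^N. *)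
Definition trunc_seq (R : realType) (wN : forall N : nat, 'cV[R]_N) (k : nat) :
  nat -> R := fun n => wN (k.+1 + n)%N (lshift n (@ord_max k)) ord0.

(* Main.v *)
(** Dividing equation i by its positive scale turns the system into the fixed
    point problem w_i = b_i + sum_j a_ij w_j with b = (1, 0, 0, ...) and
    |a_1j| = rho / j^2, |a_ij| = i rho^(i-1) (1 + rho/j) / j^i for i >= 2.
    The matrix a is not a contraction for the plain sup norm (the second
    row sum is 2 rho (zeta(2) + rho zeta(3)), close to 2), but it is one for the
    sup norm with weights (1, 53/20, 127/100, 127/100, ...) as soon as
    rho <= 913/2000, and rho1 is below that bound.  Contraction gives
    uniqueness and the regularity of every truncation.  Since the row tails
    beyond column m are O(1/m) uniformly in the row, two truncated solutions of
    sizes m <= n differ by O(1/m) on their common indices, so they converge, and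
    passing to the limit in the truncated equations shows that the limit solves
    the infinite system. *)
Require Import Defs.
From HB Require Import structures.
From mathcomp Require Import all_boot all_order all_algebra.
From mathcomp Require Import all_classical all_reals all_analysis.
From mathcomp Require Import ring lra zify.

Import Order.TTheory GRing.Theory Num.Theory.
Import numFieldNormedType.Exports.

Local Open Scope classical_set_scope.
Local Open Scope ring_scope.

Set Implicit Arguments.
Unset Strict Implicit.

(** * Telescoping bounds for sums of inverse squares and cubes *)

Lemma sum_le_telescope {R : numDomainType} (f g : nat -> R) (m n : nat) :
  (m <= n)%N -> (forall k, (m <= k)%N -> f k <= g k - g k.+1) ->
  \sum_(m <= k < n) f k <= g m - g n.
Proof.
move=> mn fg; rewrite -(opprB (g n)) -telescope_sumr// -sumrN.
by apply: ler_sum_nat => k /andP[mk _]; rewrite opprB fg.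
Qed.

Lemma telescope_le_sum {R : numDomainType} (f g : nat -> R) (m n : nat) :
  (m <= n)%N -> (forall k, (m <= k)%N -> g k - g k.+1 <= f k) ->
  g m - g n <= \sum_(m <= k < n) f k.
Proof.
move=> mn fg; rewrite -(opprB (g n)) -telescope_sumr// -sumrN.
by apply: ler_sum_nat => k /andP[mk _]; rewrite opprB fg.
Qed.

(** Midpoint telescoping: 1/(k+1/2) - 1/(k+3/2) is the inverse of (k+1/2)(k+3/2) = (k+1)^2 - 1/4,
    slightly above 1/(k+1)^2. *)
Lemma sum_inv_sqr_le {R : realFieldType} (m n : nat) : (m <= n)%N ->
  \sum_(m <= k < n) (k.+1%:R ^+ 2)^-1 <= (m%:R + 2^-1)^-1 - (n%:R + 2^-1)^-1 :> R.
Proof.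
move=> mn.
apply: (@sum_le_telescope _ _ (fun k => (k%:R + 2^-1)^-1)) => // k _.
have k0 : 0 <= k%:R :> R by [].
rewrite -(natr1 k) -subr_ge0.
suff -> : (k%:R + 2^-1)^-1 - (k%:R + 1 + 2^-1)^-1 - ((k%:R + 1) ^+ 2)^-1 =
  (4 * (k%:R + 2^-1) * (k%:R + 1 + 2^-1) * (k%:R + 1) ^+ 2)^-1 :> R.
  by rewrite invr_ge0 !mulr_ge0 ?addr_ge0 ?invr_ge0 ?exprn_ge0 ?addr_ge0.
by field; rewrite ?lt0r_neq0//; lra.
Qed.

(* The shift 1/32 is calibrated at the first index: 1/(k+1)^2 minus the
   telescoping difference has the sign of (k - 3)/16 + 1/32^2. *)
Lemma le_sum_inv_sqr {R : realFieldType} (n : nat) : (3 <= n)%N ->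
  (3 + 2^-1 + 32^-1)^-1 - (n%:R + 2^-1 + 32^-1)^-1 <=
    \sum_(3 <= k < n) (k.+1%:R ^+ 2)^-1 :> R.
Proof.
move=> mn.
apply: (@telescope_le_sum _ _ (fun k => (k%:R + 2^-1 + 32^-1)^-1)) => // k k3.
have k0 : 3 <= k%:R :> R by rewrite ler_nat.
rewrite -(natr1 k) -subr_ge0.
suff -> : ((k%:R + 1) ^+ 2)^-1 -
    ((k%:R + 2^-1 + 32^-1)^-1 - (k%:R + 1 + 2^-1 + 32^-1)^-1) =
  ((k%:R - 3) / 16 + 32^-1 ^+ 2) *
  ((k%:R + 2^-1 + 32^-1) * (k%:R + 1 + 2^-1 + 32^-1) * (k%:R + 1) ^+ 2)^-1 :> R.
  rewrite mulr_ge0 ?invr_ge0 ?mulr_ge0 ?exprn_ge0//; lra.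
by field; rewrite ?lt0r_neq0//; lra.
Qed.

(** The telescoping difference is 1/(k(k+1)(k+2)), and k(k+2) = (k+1)^2 - 1. *)
Lemma sum_inv_cube_le {R : realFieldType} (m n : nat) : (0 < m)%N -> (m <= n)%N ->
  \sum_(m <= k < n) (k.+1%:R ^+ 3)^-1 <=
    (2 * (m%:R * (m%:R + 1)))^-1 - (2 * (n%:R * (n%:R + 1)))^-1 :> R.
Proof.
move=> m0 mn.
apply: (@sum_le_telescope _ _ (fun k => (2 * (k%:R * (k%:R + 1)))^-1)) => //.
move=> k mk; have k0 : 1 <= k%:R :> R by rewrite ler1n (leq_trans m0).
rewrite -(natr1 k) -subr_ge0.
suff -> : (2 * (k%:R * (k%:R + 1)))^-1 - (2 * ((k%:R + 1) * (k%:R + 1 + 1)))^-1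
    - ((k%:R + 1) ^+ 3)^-1 =
  (k%:R * (k%:R + 1 + 1) * (k%:R + 1) ^+ 3)^-1 :> R.
  by rewrite invr_ge0 !mulr_ge0 ?exprn_ge0//; lra.
by field; rewrite ?lt0r_neq0//; lra.
Qed.

(** With m = k+1, Sophie Germain's identity (2m^2-2m+1)(2m^2+2m+1) = 4m^4+1 makes the telescoping
    difference 4m/(4m^4+1), just below 1/m^3. *)
Lemma le_sum_inv_cube {R : realFieldType} (n : nat) : (3 <= n)%N ->
  25^-1 - (2 * (n%:R * (n%:R + 1)) + 1)^-1 <=
    \sum_(3 <= k < n) (k.+1%:R ^+ 3)^-1 :> R.
Proof.
move=> mn.
have -> : 25 = 2 * (3 * (3 + 1)) + 1 :> R by ring.
apply: (@telescope_le_sum _ _ (fun k => (2 * (k%:R * (k%:R + 1)) + 1)^-1)) => //.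
move=> k k3; have k0 : 0 <= k%:R :> R by [].
have kk : 0 <= k%:R * k%:R :> R by rewrite mulr_ge0.
rewrite -(natr1 k) -subr_ge0.
suff -> : ((k%:R + 1) ^+ 3)^-1 - ((2 * (k%:R * (k%:R + 1)) + 1)^-1 -
    (2 * ((k%:R + 1) * (k%:R + 1 + 1)) + 1)^-1) =
  ((2 * (k%:R * (k%:R + 1)) + 1) * (2 * ((k%:R + 1) * (k%:R + 1 + 1)) + 1)
     * (k%:R + 1) ^+ 3)^-1 :> R.
  by rewrite invr_ge0 !mulr_ge0 ?exprn_ge0//; lra.
by field; rewrite ?lt0r_neq0//; lra.
Qed.

(** * Infinite systems with a weighted contraction *)

(** [q] is the contraction factor for the norm sup |x_i|/v_i, and [t m] bounds the row tails from
    column [m] on, uniformly in the row. Only finite sums occur, so no convergence of series is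
    presupposed. *)
Definition row_dominated {R : realType} (a : nat -> nat -> R) (v : nat -> R)
    (q : R) (t : nat -> R) : Prop :=
  [/\ 0 <= q < 1,
      forall i, 0 < v i,
      forall i n, \sum_(0 <= j < n) `|a i j| * v j <= q * v i,
      forall i m n, \sum_(m <= j < n) `|a i j| * v j <= t m * v i &
      t @ \oo --> 0].

Definition truncated_solution {R : realType} (a : nat -> nat -> R)
    (b : nat -> R) (n : nat) (u : nat -> R) : Prop :=
  forall i, (i < n)%N -> u i = b i + \sum_(0 <= j < n) a i j * u j.

Lemma ler_norm_sum_nat {R : realType} (a e v : nat -> R) (B : R) (m n : nat) :
  (forall j, (m <= j < n)%N -> `|e j| <= B * v j) ->
  `|\sum_(m <= j < n) a j * e j| <= B * \sum_(m <= j < n) `|a j| * v j.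
Proof.
move=> eB; apply: le_trans (ler_norm_sum _ _ _) _.
rewrite mulr_sumr ler_sum_nat // => j jmn.
by rewrite normrM mulrCA ler_wpM2l // eB.
Qed.

(** A maximum argument: at an index where |e|/v attains its maximum M, the hypothesis reads M <= q M
    + d. *)
Lemma row_dominated_bound {R : realType} (a : nat -> nat -> R) (v : nat -> R)
    (q : R) (t : nat -> R) (n : nat) (e : nat -> R) (d : R) :
  row_dominated a v q t -> 0 <= d ->
  (forall i, (i < n)%N ->
    `|e i| <= `|\sum_(0 <= j < n) a i j * e j| + d * v i) ->
  forall i, (i < n)%N -> `|e i| <= d / (1 - q) * v i.
Proof.
move=> [/andP[q0 q1] v0 av _ _] d0 he i ilt.
have q1' : 0 < 1 - q by rewrite subr_gt0.
case: (@arg_maxP _ _ 'I_n (Ordinal ilt) xpredT (fun k => `|e k| / v k)) => //.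
move=> k _ kmax; set m := `|e k| / v k in kmax.
have em j : (0 <= j < n)%N -> `|e j| <= m * v j.
  by move=> /andP[_ jn]; rewrite -ler_pdivrMr ?v0//; exact: (kmax (Ordinal jn)).
have m0 : 0 <= m by rewrite divr_ge0// ltW.
have : m * v k <= m * (q * v k) + d * v k.
  rewrite {1}/m divfK ?gt_eqF//.
  apply: (le_trans (he k (ltn_ord k))).
  rewrite lerD2r; apply: le_trans (ler_norm_sum_nat _ em) _.
  by rewrite ler_wpM2l.
rewrite mulrA -mulrDl ler_pM2r// => mq.
apply: le_trans (em i _) _ => //; rewrite ler_pM2r// ler_pdivlMr//.
by rewrite mulrBr mulr1 lerBlDl.
Qed.

Lemma truncated_solution_bound {R : realType} (a : nat -> nat -> R)
    (v b : nat -> R) (q : R) (t : nat -> R) (n : nat) (u : nat -> R) (d : R) :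
  row_dominated a v q t -> 0 <= d -> (forall i, `|b i| <= d * v i) ->
  truncated_solution a b n u ->
  forall i, (i < n)%N -> `|u i| <= d / (1 - q) * v i.
Proof.
move=> dom d0 bd hu; apply: (row_dominated_bound dom) => // i ilt.
by rewrite {1}hu// addrC; apply: le_trans (ler_normD _ _) _; rewrite lerD2l.
Qed.

(** On the first [m] indices the difference solves the truncated system with the columns from [m] to
    [n] as forcing term. That term is at most [t m] times d/(1-q), the bound on [u']; inverting the
    contraction costs the second factor 1/(1-q). *)
Lemma truncated_solution_dist {R : realType} (a : nat -> nat -> R)
    (v b : nat -> R) (q : R) (t : nat -> R) (m n : nat) (u u' : nat -> R)
    (d : R) :
  row_dominated a v q t -> 0 <= d -> (forall i, `|b i| <= d * v i) ->
  (m <= n)%N ->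
  truncated_solution a b m u -> truncated_solution a b n u' ->
  forall i, (i < m)%N -> `|u' i - u i| <= t m * (d / (1 - q) ^+ 2) * v i.
Proof.
move=> dom d0 bd mn hu hu' i im.
have bnd := truncated_solution_bound dom d0 bd hu'.
have [/andP[q0 q1] v0 av tv _] := dom.
have q1' : 0 < 1 - q by rewrite subr_gt0.
have tm0 : 0 <= t m.
  by have := tv 0%N m m; rewrite big_geq// pmulr_lge0.
suff: `|u' i - u i| <= t m * (d / (1 - q)) / (1 - q) * v i.
  by rewrite -!mulrA (mulrA (1 - q)^-1) -invfM -expr2.
apply: (row_dominated_bound (e := fun i => u' i - u i) dom) (im) => {i im}.
  by rewrite mulr_ge0// divr_ge0// ltW.
move=> i im; have iN := leq_trans im mn.
rewrite hu// hu'// (big_cat_nat (leq0n m) mn)/=.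
rewrite opprD addrACA subrr add0r addrAC -sumrB.
apply: le_trans (ler_normD _ _) _; apply: lerD.
  by under [in leRHS]eq_bigr do rewrite mulrBr.
rewrite [t m * _]mulrC -mulrA.
apply: le_trans (ler_norm_sum_nat _ (B := d / (1 - q)) (v := v) _) _.
  by move=> j /andP[_ jn]; exact: bnd.
by rewrite ler_wpM2l// divr_ge0// ltW.
Qed.

(** Each substitution of z into the homogeneous fixed point equation gains a factor q, so |z| <= q^n
    B v for every n. *)
Lemma row_dominated_unique {R : realType} (a : nat -> nat -> R)
    (v : nat -> R) (q : R) (t : nat -> R) (z : nat -> R) (B : R) :
  row_dominated a v q t -> (forall i, `|z i| <= B * v i) ->
  (forall i, series (fun j => a i j * z j) @ \oo --> z i) ->
  forall i, z i = 0.
Proof.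
move=> [/andP[q0 q1] v0 av _ _] zB zs i.
have B0 : 0 <= B by rewrite -(pmulr_lge0 _ (v0 0%N)); exact: le_trans (zB 0%N).
have zn n k : `|z k| <= q ^+ n * B * v k.
  elim: n k => [|n IH] k; first by rewrite mul1r.
  have c : (fun n => `|series (fun j => a k j * z j) n|) @ \oo --> `|z k|.
    exact: cvg_norm.
  rewrite -(cvg_lim _ c)//; apply: limr_le; first by apply/cvg_ex; exists `|z k|.
  near=> N; rewrite /series/=.
  apply: le_trans (ler_norm_sum_nat _ (B := q ^+ n * B) (v := v) _) _ => //.
  have -> : q ^+ n.+1 * B * v k = q ^+ n * B * (q * v k) by rewrite exprS; ring.
  by rewrite ler_wpM2l ?mulr_ge0 ?exprn_ge0.
have zl : (fun n => q ^+ n * B * v i) @ \oo --> 0 * B * v i.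
  apply: cvgMl; apply: cvgMl; apply: cvg_expr.
  by rewrite ger0_norm.
apply/normr0_eq0/eqP; rewrite -normr_le0.
rewrite !mul0r in zl; rewrite -(cvg_lim _ zl)//.
apply: limr_ge; first by apply/cvg_ex; exists 0.
by apply: nearW => n; rewrite normr_id; exact: zn.
Unshelve. all: by end_near. Qed.

Lemma truncated_solution_cvg {R : realType} (a : nat -> nat -> R)
    (v b : nat -> R) (q : R) (t : nat -> R) (u : nat -> nat -> R) (d : R) :
  row_dominated a v q t -> 0 <= d -> (forall i, `|b i| <= d * v i) ->
  (forall n, truncated_solution a b n (u n)) ->
  exists w : nat -> R,
    [/\ forall i, `|w i| <= d / (1 - q) * v i,
        forall i, series (fun j => a i j * w j) @ \oo --> w i - b i &
        forall i, u ^~ i @ \oo --> w i].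
Proof.
move=> dom d0 bd hu.
have bnd n := truncated_solution_bound dom d0 bd (hu n).
have dist m n mn := truncated_solution_dist dom d0 bd mn (hu m) (hu n).
have [/andP[q0 q1] v0 av tv t0] := dom.
set K := d / (1 - q) ^+ 2 in dist.
have tK i : (fun m => t m * K * v i) @ \oo --> 0.
  by rewrite -(mul0r (v i)) -(mul0r K); apply: cvgMl; exact: cvgMl.
have uc i : cvgn (u ^~ i).
  apply/cauchy_cvgP/cauchy_exP => e e0.
  have /cvgrPdist_lt /(_ _ e0) [n0 _ hn0] := tK i.
  (* The maximum with [i.+1] keeps index [i] inside the truncation, where [dist] applies. *)
  exists (u (maxn n0 i.+1) i).
  exists (maxn n0 i.+1) => // n /= hn.
  rewrite /ball/= distrC; apply: le_lt_trans (dist _ _ hn i _) _.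
    by rewrite leq_max ltnSn orbT.
  apply: le_lt_trans (hn0 (maxn n0 i.+1) _) => /=; last by rewrite leq_maxl.
  by rewrite sub0r normrN ler_norm.
pose w i := limn (u ^~ i); exists w.
have wu i : u ^~ i @ \oo --> w i by exact: uc.
have wdist m i : (i < m)%N -> `|w i - u m i| <= t m * K * v i.
  move=> im.
  have c : (fun n => `|u n i - u m i|) @ \oo --> `|w i - u m i|.
    by apply: cvg_norm; apply: cvgB; [exact: wu|exact: cvg_cst].
  rewrite -(cvg_lim _ c)//; apply: limr_le; first by apply/cvg_ex; eexists; exact: c.
  by exists m => // n /= mn; exact: dist.
split=> // i.
- have c : (fun n => `|u n i|) @ \oo --> `|w i| by exact: cvg_norm.
  rewrite -(cvg_lim _ c)//; apply: limr_le; first by apply/cvg_ex; eexists; exact: c.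
  by exists i.+1 => // n /= mn; exact: bnd.
(* Squeeze: by the equation of [u n], the residual of w in row i is (w_i - u_i) minus the sum of
   a_ij (w_j - u_j) over j < n, and each of the two parts is at most t_n K v_i. *)
- have c : (fun n => w i - b i - t n * K * v i *+ 2) @ \oo --> w i - b i.
    rewrite -[X in _ --> X]subr0; apply: cvgB; first exact: cvg_cst.
    by rewrite -(mul0rn _ 2); exact: cvgMn.
  have c' : (fun n => w i - b i + t n * K * v i *+ 2) @ \oo --> w i - b i.
    rewrite -[X in _ --> X]addr0; apply: cvgD; first exact: cvg_cst.
    by rewrite -(mul0rn _ 2); exact: cvgMn.
  apply: (squeeze_cvgr _ c c').
  exists i.+1 => // n /= ni.
  rewrite -ler_distlC.
  have -> : w i - b i - series (fun j => a i j * w j) n =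
     (w i - u n i) - \sum_(0 <= j < n) a i j * (w j - u n j).
    under [in RHS]eq_bigr do rewrite mulrBr.
    rewrite sumrB (hu n i)//= /series/=; ring.
  apply: le_trans (ler_normB _ _) _; rewrite mulr2n; apply: lerD.
    exact: wdist.
  apply: le_trans (ler_norm_sum_nat _ (B := t n * K) (v := v) _) _.
    by move=> j /andP[_ jn]; exact: wdist.
  have tn0 : 0 <= t n by have := tv 0%N n n; rewrite big_geq// pmulr_lge0.
  rewrite ler_wpM2l//.
    by rewrite mulr_ge0// divr_ge0// exprn_ge0// subr_ge0 ltW.
  by apply: le_trans (av i n) _; rewrite ler_piMl// ltW.
Qed.

(** * The root rho1 *)

Lemma riemannR_natE {R : realType} (s n : nat) :
  riemannR s%:R n = (n.+1%:R ^+ s)^-1 :> R.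
Proof. by rewrite /riemannR powR_mulrn. Qed.

(** The first three terms are kept exact, since the telescoping bounds are sharp enough only from
    there on. As partial sums increase, a single one gives the lower bound. *)
Lemma zeta_bounds {R : realType} (s : nat) (lo hi : R) :
  (forall n, (3 <= n)%N -> \sum_(3 <= k < n) (k.+1%:R ^+ s)^-1 <= hi) ->
  (exists2 n, (3 <= n)%N & lo <= \sum_(3 <= k < n) (k.+1%:R ^+ s)^-1) ->
  1 + (2 ^+ s)^-1 + (3 ^+ s)^-1 + lo <= zeta s%:R
    <= 1 + (2 ^+ s)^-1 + (3 ^+ s)^-1 + hi.
Proof.
move=> hhi [n0 n03 hlo].
set c := 1 + _ + _.
have serE n : (3 <= n)%N -> series (riemannR s%:R) n =
    c + \sum_(3 <= k < n) (k.+1%:R ^+ s)^-1 :> R.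
  move=> n3; rewrite /series/= (eq_bigr (fun k => (k.+1%:R ^+ s)^-1)).
    rewrite (big_cat_nat (leq0n 3) n3)/=; congr (_ + _).
    by rewrite !big_nat_recl// big_geq// expr1n invr1 addr0 addrA.
  by move=> k _; exact: riemannR_natE.
have nd : {homo series (@riemannR R s%:R) : n m / (n <= m)%N >-> n <= m}.
  apply: nondecreasing_series => n _ _; rewrite riemannR_natE.
  by rewrite invr_ge0 exprn_ge0.
have ub n : series (@riemannR R s%:R) n <= c + hi.
  apply: le_trans (nd _ (maxn n 3) _) _; first exact: leq_maxl.
  by rewrite serE ?leq_maxr// lerD2l hhi// leq_maxr.
have cv : cvgn (series (@riemannR R s%:R)).
  by apply: nondecreasing_is_cvgn => //; exists (c + hi) => _ [n _ <-].
apply/andP; split; last by apply: limr_le => //; exact: nearW.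
apply: le_trans (nondecreasing_cvgn_le nd cv n0).
by rewrite serE// lerD2l.
Qed.

Lemma zeta2_bounds {R : realType} :
  (1643 / 1000 <= zeta 2 :> R) && (zeta 2 <= 1647 / 1000 :> R).
Proof.
have := @zeta_bounds R 2 (282 / 1000) ((3 + 2^-1)^-1); case/(_ _ _)/andP.
- move=> n n3; apply: le_trans (sum_inv_sqr_le n3) _.
  by rewrite gerBl invr_ge0 addr_ge0.
- exists 1000%N => //; apply: le_trans (le_sum_inv_sqr _) => //.
  have lo : 283 / 1000 <= (3 + 2^-1 + 32^-1)^-1 :> R.
    by rewrite -[leRHS]mul1r ler_pdivlMr; lra.
  have hi : (1000%:R + 2^-1 + 32^-1)^-1 <= 1 / 1000 :> R.
    by rewrite -[leLHS]mul1r ler_pdivrMr; lra.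
  by lra.
- have -> : (3 + 2^-1)^-1 = 2 / 7 :> R by field.
  by move=> lo hi; apply/andP; split; lra.
Qed.

Lemma zeta3_bounds {R : realType} :
  (12 / 10 <= zeta 3 :> R) && (zeta 3 <= 6019 / 5000 :> R).
Proof.
have := @zeta_bounds R 3 (39 / 1000) (24^-1); case/(_ _ _)/andP.
- move=> n n3; apply: le_trans (sum_inv_cube_le _ n3) _ => //.
  have -> : (2 * (3 * (3 + 1)))^-1 = 24^-1 :> R by field.
  by rewrite gerBl invr_ge0 !mulr_ge0 ?addr_ge0.
- exists 100%N => //; apply: le_trans (le_sum_inv_cube _) => //.
  have hi : (2 * (100%:R * (100%:R + 1)) + 1)^-1 <= 1 / 1000 :> R.
    by rewrite -[leLHS]mul1r ler_pdivrMr; lra.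
  by lra.
- by move=> lo hi; apply/andP; split; lra.
Qed.

Lemma ltr_pquad {R : realFieldType} (a b x y : R) :
  0 < a -> 0 < b -> 0 < x -> x < y -> x * (a + x * b) < y * (a + y * b).
Proof.
move=> a0 b0 x0 xy; rewrite ltr_pM ?(ltW x0)//.
  by rewrite addr_ge0 ?mulr_ge0 ?ltW.
by rewrite ltrD2l ltr_pM2r.
Qed.

Lemma zeta23_gt0 {R : realType} : 0 < zeta 2 :> R /\ 0 < zeta 3 :> R.
Proof.
have /andP[z2 _] := @zeta2_bounds R; have /andP[z3 _] := @zeta3_bounds R.
by split; [apply: lt_le_trans z2|apply: lt_le_trans z3]; lra.
Qed.

Lemma pos_root_unique {R : realType} (r r' : R) :
  is_pos_root r -> is_pos_root r' -> r = r'.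
Proof.
have [z2 z3] := @zeta23_gt0 R.
move=> [r0 hr] [r0' hr']; apply/eqP; case: ltgtP => // rr.
  by have := ltr_pquad z2 z3 r0 rr; rewrite hr hr' ltxx.
by have := ltr_pquad z2 z3 r0' rr; rewrite hr hr' ltxx.
Qed.

(** The endpoints are 0.456 -+ 1/2000. By monotonicity it suffices that the quadratic is below 1 at
    the left one and above 1 at the right one; the margins are about 3/10^5 and 10^-4, which
    dictates the precision of the zeta bounds. *)
Lemma pos_root_bounds {R : realType} (r : R) :
  is_pos_root r -> (911 / 2000 <= r) && (r <= 913 / 2000).
Proof.
have [z2 z3] := @zeta23_gt0 R.
have /andP[lo2 hi2] := @zeta2_bounds R; have /andP[lo3 hi3] := @zeta3_bounds R.
move=> [r0 hr].
have clear_den (c d x : R) : 0 < d -> d * (c / d * x) = c * x.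
  by move=> d0; rewrite mulrA mulrCA divff ?gt_eqF// mulr1.
have d0 : 0 < 2000 :> R by rewrite ltr0n.
apply/andP; split; rewrite leNgt; apply/negP => rc.
  have := ltr_pquad z2 z3 r0 rc; rewrite hr => {r r0 hr rc}.
  have := clear_den 911 _ (zeta 3) d0.
  have := clear_den 911 _ (zeta 2 + 911 / 2000 * zeta 3) d0.
  (* The nested products become variables tied to zeta only through the two denominator-free
     equations, which leaves a linear problem. *)
  move: (911 / 2000 * zeta 3) => y; move: (911 / 2000 * _) => x.
  lra.
have c0 : 0 < 913 / 2000 :> R by rewrite divr_gt0 ?ltr0n.
have := ltr_pquad z2 z3 c0 rc; rewrite hr => {r r0 hr rc c0}.
have := clear_den 913 _ (zeta 3) d0.
have := clear_den 913 _ (zeta 2 + 913 / 2000 * zeta 3) d0.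
move: (913 / 2000 * zeta 3) => y; move: (913 / 2000 * _) => x.
lra.
Qed.

Lemma pos_root_exists {R : realType} : exists r : R, is_pos_root r.
Proof.
have [z2 z3] := @zeta23_gt0 R.
rewrite /is_pos_root; move: (zeta 2 : R) (zeta 3 : R) z2 z3 => a b a0 b0.
have d0 : 0 <= a ^+ 2 + 4 * b by rewrite addr_ge0 ?sqr_ge0//; lra.
set s := Num.sqrt (a ^+ 2 + 4 * b).
have s2 : s ^+ 2 = a ^+ 2 + 4 * b by rewrite sqr_sqrtr.
have s0 : 0 <= s by exact: sqrtr_ge0.
have as0 : 0 < a + s by lra.
(* The quadratic formula for b r^2 + a r = 1, with the numerator rationalised. *)
exists (2 / (a + s)); split; first by rewrite divr_gt0.
have : 4 * b = (s - a) * (s + a) by rewrite -subr_sqr s2; ring.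
move=> b4.
have -> : b = (s - a) * (s + a) / 4 by rewrite -b4; field.
by field; lra.
Qed.

(** * The contraction estimate *)

(* Indices are shifted: [kernel rho i j] is a_(i+1)(j+1). *)
Definition kernel {R : realType} (rho : R) (i j : nat) : R :=
  (-1) ^+ j * (if i == 0%N then rho / j.+1%:R ^+ 2
               else i.+1%:R * rho ^+ i * ((1 + rho / j.+1%:R) / j.+1%:R ^+ i.+1)).

(* Found numerically: the weighted row sums at rho = 913/2000 leave room for
   the ratio 199/200 in each of the rows 1, 2 and 3. *)
Definition weight {R : realType} (j : nat) : R :=
  match j with 0 => 1 | 1 => 53 / 20 | _ => 127 / 100 end.

Lemma weight_bounds {R : realType} (j : nat) :
  (1 <= weight j :> R) && (weight j <= 3 :> R).
Proof. by case: j => [|[|j]] /=; apply/andP; split; lra. Qed.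

(** Consecutive terms have ratio rho (i+2)/(i+1) <= 2 rho < 1. *)
Lemma natmul_exp_le {R : realType} (rho : R) (i : nat) :
  0 < rho -> rho <= 913 / 2000 -> (2 <= i)%N -> i.+1%:R * rho ^+ i <= 3 * rho ^+ 2.
Proof.
move=> r0 r1; elim: i => // i IH; rewrite leq_eqVlt => /predU1P[<-//|i2].
apply: le_trans (IH i2).
rewrite exprS mulrA ler_wpM2r ?exprn_ge0 ?ltW// -[i.+2%:R]natr1.
have : 1 <= i.+1%:R :> R by rewrite ler1n.
by nra.
Qed.

Lemma normr_kernel0 {R : realType} (rho : R) (j : nat) :
  0 < rho -> `|kernel rho 0 j| = rho * (j.+1%:R ^+ 2)^-1.
Proof.
move=> r0; rewrite /kernel /= normrM normrX normrN1 expr1n mul1r ger0_norm//.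
by rewrite divr_ge0 ?exprn_ge0 ?ltW.
Qed.

Lemma normr_kernelS {R : realType} (rho : R) (i j : nat) :
  0 < rho -> `|kernel rho i.+1 j| =
    i.+2%:R * rho ^+ i.+1 * ((1 + rho / j.+1%:R) * (j.+1%:R ^+ i.+2)^-1).
Proof.
move=> r0; rewrite /kernel /= normrM normrX normrN1 expr1n mul1r ger0_norm//.
by rewrite !mulr_ge0 ?invr_ge0 ?exprn_ge0 ?addr_ge0 ?divr_ge0// ltW.
Qed.

Lemma sum_le_split2 {R : realType} (f : nat -> R) (B : R) (n : nat) :
  (forall j, 0 <= f j) ->
  (forall n, (2 <= n)%N -> \sum_(2 <= j < n) f j <= B) ->
  \sum_(0 <= j < n) f j <= f 0%N + f 1%N + B.
Proof.
(* Padding to length n+2 ensures that both isolated terms are present even when n < 2. *)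
move=> f0 fB; apply: (@le_trans _ _ (\sum_(0 <= j < n.+2) f j)).
  by rewrite [leRHS](@big_cat_nat _ _ _ n)//= ?lerDl ?sumr_ge0//; lia.
by rewrite (big_cat_nat (leq0n 2))//= lerD ?fB// big_nat_recl// big_nat1.
Qed.

(** The first two columns are kept exactly; beyond them the weight is constant and rho/j <= rho/3,
    leaving only a sum of inverse powers to bound by [S]. *)
Lemma kernel_row_bound {R : realType} (rho : R) (i n : nat) (S : R) :
  0 < rho ->
  (forall n, (2 <= n)%N -> \sum_(2 <= j < n) (j.+1%:R ^+ i.+2)^-1 <= S) ->
  \sum_(0 <= j < n) `|kernel rho i.+1 j| * weight j <=
    i.+2%:R * rho ^+ i.+1 *
      (1 + rho + (1 + rho / 2) / 2 ^+ i.+2 * (53 / 20)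
        + (1 + rho / 3) * (127 / 100) * S).
Proof.
move=> r0 hS; set p := _ * rho ^+ _.
have p0 : 0 <= p by rewrite mulr_ge0 ?exprn_ge0 ?ltW.
have e j : `|kernel rho i.+1 j| * weight j =
    p * ((1 + rho / j.+1%:R) / j.+1%:R ^+ i.+2 * weight j).
  by rewrite normr_kernelS// -[LHS]mulrA.
rewrite (eq_bigr _ (fun j _ => e j)) -mulr_sumr.
rewrite ler_wpM2l//.
apply: le_trans (sum_le_split2 (B := (1 + rho / 3) * (127 / 100) * S) _ _ _) _.
- move=> j; have /andP[w0 _] := @weight_bounds R j.
  rewrite !mulr_ge0 ?invr_ge0 ?exprn_ge0 ?addr_ge0 ?divr_ge0 ?ltW//.
  exact: lt_le_trans w0.
- move=> m m2; apply: (@le_trans _ _ ((1 + rho / 3) * (127 / 100) *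
      \sum_(2 <= j < m) (j.+1%:R ^+ i.+2)^-1)).
    rewrite mulr_sumr; apply: ler_sum_nat => -[|[|j]]// _ /=.
    rewrite mulrAC; apply: ler_wpM2r; first by rewrite invr_ge0 exprn_ge0.
    apply: ler_wpM2r; first by lra.
    rewrite lerD2l; apply: ler_wpM2l; first exact: ltW.
    by rewrite lef_pV2 ?posrE ?ltr0n// ler_nat.
  by rewrite ler_wpM2l ?hS// !mulr_ge0 ?addr_ge0 ?divr_ge0// ?ltW//; lra.
by rewrite lerD2r /= !divr1 expr1n invr1 !mulr1 lerD2l.
Qed.

(** The first two rows are checked separately. All later rows are handled at once: their prefactor
    is at most 3 rho^2 <= 626/1000 and their inverse powers are at most inverse cubes. *)
Lemma kernel_row_le {R : realType} (rho : R) (i n : nat) :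
  0 < rho -> rho <= 913 / 2000 ->
  \sum_(0 <= j < n) `|kernel rho i j| * weight j <= 199 / 200 * weight i.
Proof.
move=> r0 r1.
have sq m : (2 <= m)%N -> \sum_(2 <= j < m) (j.+1%:R ^+ 2)^-1 <= 2 / 5 :> R.
  move=> m2; apply: le_trans (sum_inv_sqr_le m2) _.
  have -> : (2 + 2^-1)^-1 = 2 / 5 :> R by field.
  by rewrite gerBl invr_ge0 addr_ge0.
have cu m k : (2 <= m)%N ->
    \sum_(2 <= j < m) (j.+1%:R ^+ k.+3)^-1 <= 1 / 12 :> R.
  move=> m2; apply: (@le_trans _ _ (\sum_(2 <= j < m) (j.+1%:R ^+ 3)^-1)).
    apply: ler_sum => j _; rewrite lef_pV2 ?posrE ?exprn_gt0 ?ltr0n//.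
    by rewrite -(addn3 k) exprD ler_peMl ?exprn_ge0// exprn_ege1// ler1n.
  apply: le_trans (sum_inv_cube_le _ m2) _ => //.
  have -> : (2 * (2 * (2 + 1)))^-1 = 1 / 12 :> R by field.
  by rewrite gerBl invr_ge0 !mulr_ge0 ?addr_ge0.
case: i => [|[|i]].
- apply: le_trans (sum_le_split2 (B := rho * (127 / 100) * (2 / 5)) _ _ _) _.
  + by move=> j; rewrite mulr_ge0//; have /andP[] := @weight_bounds R j; lra.
  + move=> m m2; apply: le_trans (ler_wpM2l _ (sq m m2)).
      rewrite mulr_sumr; apply: ler_sum_nat => -[|[|j]]// _.
      by rewrite normr_kernel0//= mulrAC.
    by lra.
  + rewrite !normr_kernel0//=; lra.
- apply: le_trans (kernel_row_bound _ r0 sq) _ => /=.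
  by nra.
- apply: le_trans (kernel_row_bound _ r0 (cu ^~ i)) _ => /=.
  have p_le : i.+3%:R * rho ^+ i.+2 <= 626 / 1000 :> R.
    by apply: le_trans (natmul_exp_le r0 r1 _) _ => //; nra.
  have inv_le : (2 ^+ i.+3)^-1 <= 1 / 8 :> R.
    have -> : 1 / 8 = (2 ^+ 3)^-1 :> R by rewrite mul1r; congr (_^-1); ring.
    by rewrite lef_pV2 ?posrE ?exprn_gt0// ler_eXn2l// ltr1n.
  have inv_ge : 0 <= (2 ^+ i.+3)^-1 :> R by rewrite invr_ge0 exprn_ge0.
  set x := (2 ^+ i.+3)^-1 in inv_le inv_ge *.
  have xle : (1 + rho / 2) * x <= (1 + rho / 2) * (1 / 8).
    by apply: ler_wpM2l => //; lra.
  have x0 : 0 <= (1 + rho / 2) * x by rewrite mulr_ge0//; lra.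
  apply: (@le_trans _ _ (626 / 1000 * (199 / 100))); last by lra.
  apply: ler_pM => //; last by lra.
    by rewrite mulr_ge0 ?exprn_ge0 ?ltW.
  by lra.
Qed.

(** A summable majorant common to all rows, from which the uniform tail bound follows. *)
Lemma normr_kernel_le {R : realType} (rho : R) (i j : nat) :
  0 < rho -> rho <= 913 / 2000 ->
  `|kernel rho i j| <= 2 * (j.+1%:R ^+ 2)^-1.
Proof.
move=> r0 r1; have j0 : 0 <= (j.+1%:R ^+ 2)^-1 :> R.
  by rewrite invr_ge0 exprn_ge0.
case: i => [|i].
  by rewrite normr_kernel0//; apply: ler_wpM2r => //; lra.
rewrite normr_kernelS// mulrA; apply: ler_pM.
- by rewrite !mulr_ge0 ?exprn_ge0 ?addr_ge0 ?divr_ge0// ltW.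
- by rewrite invr_ge0 exprn_ge0.
- have -> : 2 = 1 * 2 :> R by rewrite mul1r.
  apply: ler_pM.
  + by rewrite mulr_ge0 ?exprn_ge0 ?ltW.
  + by rewrite addr_ge0 ?divr_ge0 ?ltW.
  + case: i => [|i]; first by rewrite expr1; lra.
    by apply: le_trans (natmul_exp_le r0 r1 _) _ => //; nra.
  + have : rho / j.+1%:R <= rho by rewrite ler_pdivrMr// ler_peMr ?ler1n// ltW.
    move: (rho / _) => x; lra.
- rewrite lef_pV2 ?posrE ?exprn_gt0 ?ltr0n//.
  by rewrite ler_weXn2l// ler1n.
Qed.

Lemma kernel_tail_le {R : realType} (rho : R) (i m n : nat) :
  0 < rho -> rho <= 913 / 2000 ->
  \sum_(m <= j < n) `|kernel rho i j| * weight j <= 12 * harmonic m * weight i.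
Proof.
move=> r0 r1.
have /andP[w1 _] := @weight_bounds R i.
have h0 : 0 <= 12 * harmonic m :> R by rewrite mulr_ge0// invr_ge0.
apply: (@le_trans _ _ (12 * harmonic m)); last by rewrite ler_peMr.
have [nm|/ltnW mn] := leqP n m; first by rewrite big_geq.
apply: (@le_trans _ _ (6 * \sum_(m <= j < n) (j.+1%:R ^+ 2)^-1)).
  rewrite mulr_sumr; apply: ler_sum => j _.
  have -> : 6 = 2 * 3 :> R by ring.
  rewrite mulrAC; have /andP[w0 w3] := @weight_bounds R j.
  by apply: ler_pM => //; [lra|exact: normr_kernel_le].
(* The constant is 2 (kernel) times 3 (weight) times 2, from 1/(m+1/2) <= 2/(m+1) with [harmonic m]
   = 1/(m+1). *)
have -> : 12 * harmonic m = 6 * (2 * harmonic m) :> R by ring.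
apply: ler_wpM2l => //; apply: le_trans (sum_inv_sqr_le mn) _.
apply: (@le_trans _ _ (m%:R + 2^-1)^-1).
  by rewrite gerBl invr_ge0 addr_ge0.
have m0 : 0 <= m%:R :> R by [].
rewrite /harmonic -[leLHS]mul1r ler_pdivrMr; last by lra.
rewrite mulrAC ler_pdivlMr ?ltr0n// -natr1; lra.
Qed.

Lemma kernel_dominated {R : realType} (rho : R) :
  0 < rho -> rho <= 913 / 2000 ->
  row_dominated (kernel rho) weight (199 / 200) (fun m => 12 * harmonic m).
Proof.
move=> r0 r1; split.
- by apply/andP; split; lra.
- by move=> i; have /andP[w1 _] := @weight_bounds R i; exact: lt_le_trans w1.
- by move=> i n; exact: kernel_row_le.
- by move=> i m n; exact: kernel_tail_le.
- by rewrite -(mulr0 12); apply: cvgMr; exact: cvg_harmonic.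
Qed.

(** * The linear system as a fixed point problem *)

Definition scale {R : realType} (rho : R) (i : nat) : R :=
  if i == 0%N then 1 else rho `^ (- (i.+1%:R / 2)) / i.+1%:R.

Lemma scale_gt0 {R : realType} (rho : R) (i : nat) : 0 < rho -> 0 < scale rho i.
Proof.
by move=> r0; rewrite /scale; case: eqP => // _; rewrite divr_gt0 ?powR_gt0.
Qed.

(** Since rho^(i/2-1) = rho^(-i/2) rho^(i-1), the scale factors out of each row; the extra diagonal
    term becomes the -1 of the identity matrix. *)
Lemma coefE {R : realType} (rho : R) (i j : nat) : 0 < rho ->
  coef rho i.+1 j.+1 = scale rho i * (kernel rho i j - (i == j)%:R).
Proof.
move=> r0; rewrite /coef /scale /kernel !eqSS.
case: i => [|i] /=.
  case: j => [|j] /=; first by rewrite expr0 expr1n divr1 !mul1r; ring.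
  by rewrite subr0 mul1r.
have rn : rho != 0 by rewrite gt_eqF.
have -> : rho `^ (i.+2%:R / 2 - 1) = rho `^ (- (i.+2%:R / 2)) * rho ^+ i.+1.
  rewrite -powR_mulrn ?(ltW r0)// -powRD ?rn ?implybT//; congr (_ `^ _).
  by rewrite -(natr1 i.+1); field.
have i0 : i.+2%:R != 0 :> R by rewrite pnatr_eq0.
rewrite eq_sym; case: eqVneq => [<-|_] /=.
  move: (i.+2%:R) i0 (rho `^ _) => n n0 y.
  rewrite mulrBr mulr1; congr (_ - _).
  by move: (n ^- _) => z; field.
move: (i.+2%:R) i0 (rho `^ _) => n n0 y.
by rewrite subr0; move: (j.+1%:R ^- _) (rho / j.+1%:R) => z c; field.
Qed.

Definition unit_rhs {R : realType} (i : nat) : R := (i == 0%N)%:R.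

Lemma rhsE {R : realType} (rho : R) (i : nat) :
  rhs R i.+1 = - (scale rho i * unit_rhs i).
Proof.
by rewrite /rhs /scale /unit_rhs eqSS; case: i => [|i] /=; rewrite ?mulr1 ?mulr0 ?oppr0.
Qed.

(** Extension by zero, so that column vectors of all sizes become sequences. *)
Definition vec_seq {R : realType} {N : nat} (v : 'cV[R]_N) (k : nat) : R :=
  if insub k is Some i then v i ord0 else 0.

Lemma vec_seq_ord {R : realType} {N : nat} (v : 'cV[R]_N) (i : 'I_N) :
  vec_seq v i = v i ord0.
Proof. by rewrite /vec_seq valK. Qed.

Lemma sum_delta {R : realType} (N i : nat) (x : nat -> R) :
  \sum_(0 <= j < N) (i == j)%:R * x j = if (i < N)%N then x i else 0.
Proof.
rewrite big_mkord; case: ltnP => [iN|Ni].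
  rewrite (bigD1 (Ordinal iN))//= eqxx mul1r big1 ?addr0// => j ji.
  by rewrite (_ : (i == j) = false) ?mul0r//; apply/eqP => ij; case/eqP: ji; apply: val_inj.
by apply: big1 => j _; rewrite (_ : (i == j) = false) ?mul0r//; have := ltn_ord j; lia.
Qed.

Lemma coef_sumE {R : realType} (rho : R) (i N : nat) (x : nat -> R) : 0 < rho ->
  \sum_(0 <= j < N) coef rho i.+1 j.+1 * x j =
    scale rho i * (\sum_(0 <= j < N) kernel rho i j * x j
                   - if (i < N)%N then x i else 0).
Proof.
move=> r0; rewrite -sum_delta -sumrB mulr_sumr; apply: eq_bigr => j _.
by rewrite coefE// -mulrA mulrBl.
Qed.

Lemma trunc_mx_mulE {R : realType} (rho : R) (N : nat) (v : 'cV[R]_N) (i : 'I_N) :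
  0 < rho ->
  (trunc_mx rho N *m v) i ord0 =
    scale rho i * (\sum_(0 <= j < N) kernel rho i j * vec_seq v j - vec_seq v i).
Proof.
move=> r0; have := coef_sumE i N (vec_seq v) r0.
rewrite ltn_ord vec_seq_ord => <-; rewrite mxE big_mkord.
by apply: eq_bigr => j _; rewrite mxE vec_seq_ord.
Qed.

Lemma trunc_solutionP {R : realType} (rho : R) (N : nat) (v : 'cV[R]_N) :
  0 < rho ->
  trunc_solution rho v <-> truncated_solution (kernel rho) unit_rhs N (vec_seq v).
Proof.
move=> r0; have sn0 i : scale rho i != 0 by rewrite gt_eqF ?scale_gt0.
split=> [sol i iN|sol].
  have /matrixP/(_ (Ordinal iN) ord0) := sol.
  rewrite trunc_mx_mulE// mxE (rhsE rho)/= -mulrN => /(mulfI (sn0 i)) h.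
  by rewrite -[LHS](subKr (\sum_(0 <= j < N) kernel rho i j * vec_seq v j)) h; ring.
apply/matrixP => i k; rewrite (ord1 k) trunc_mx_mulE// mxE (rhsE rho) -mulrN.
by congr (_ * _); rewrite [in LHS](sol i)//; ring.
Qed.

(** A kernel vector solves the truncated fixed point problem with b = 0, so the a priori bound with
    d = 0 annihilates it. *)
Lemma trunc_mx_unit {R : realType} (rho : R) (N : nat) :
  0 < rho -> rho <= 913 / 2000 -> trunc_mx rho N \in unitmx.
Proof.
(* [det0P] yields a row vector in the left kernel, hence the transposition. *)
move=> r0 r1; rewrite unitmxE unitfE -det_tr; apply/negP => /det0P[v vn0].
move=> /(congr1 trmx); rewrite trmx_mul trmxK trmx0 => h.
case/eqP: vn0; apply: (can_inj (@trmxK _ _ _)); rewrite trmx0.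
apply/matrixP => i k; rewrite (ord1 k) [RHS]mxE.
have sol : truncated_solution (kernel rho) (fun=> 0) N (vec_seq v^T).
  move=> j jN; have /matrixP/(_ (Ordinal jN) ord0) := h.
  rewrite trunc_mx_mulE// mxE => /eqP.
  by rewrite mulf_eq0 gt_eqF ?scale_gt0//= subr_eq0 add0r eq_sym => /eqP.
have := truncated_solution_bound (kernel_dominated r0 r1) (lexx 0) _ sol (ltn_ord i).
rewrite !mul0r vec_seq_ord normr_le0 => z; apply/eqP; apply: z => j.
by rewrite normr0 mul0r.
Qed.

Lemma bounded_funP_nat {R : realType} (w : nat -> R) :
  bounded_fun w <-> exists M, forall i, `|w i| <= M.
Proof.
have PF := globally_properfilter (I : [set: nat] 0%N).
rewrite /= ex_bound; split=> -[M hM]; exists M; last by move=> i _; exact: hM.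
by move=> i; exact: hM.
Qed.

Lemma solves_systemP {R : realType} (rho : R) (w : nat -> R) : 0 < rho ->
  solves_system rho w <->
  forall i, series (fun j => kernel rho i j * w j) @ \oo --> w i - unit_rhs i.
Proof.
move=> r0.
(* Only for n > i does the partial sum contain the diagonal term, so the identity holds
   eventually. *)
have e i : \forall n \near \oo, series (fun k => coef rho i.+1 k.+1 * w k) n =
    scale rho i * (series (fun j => kernel rho i j * w j) n - w i).
  by exists i.+1 => // n /= ni; rewrite /series/= coef_sumE// ni.
have sn0 i : scale rho i != 0 by rewrite gt_eqF ?scale_gt0.
split=> [sol i|sol [//|i] _].
  have := sol i.+1 isT; rewrite (rhsE rho) => c.
  have c' : (fun n => (scale rho i)^-1 *
      series (fun k => coef rho i.+1 k.+1 * w k) n + w i) @ \oo -->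
      (scale rho i)^-1 * - (scale rho i * unit_rhs i) + w i.
    by apply: cvgD; [exact: cvgMr|exact: cvg_cst].
  rewrite -mulrN mulKf// addrC in c'.
  apply: cvg_trans c'; apply: near_eq_cvg.
  by near=> n; rewrite (near (e i) n)// mulKf// subrK.
rewrite (rhsE rho).
have c : (fun n => scale rho i * (series (fun j => kernel rho i j * w j) n - w i))
    @ \oo --> scale rho i * (w i - unit_rhs i - w i).
  by apply: cvgMr; apply: cvgB; [exact: sol|exact: cvg_cst].
rewrite addrAC subrr add0r mulrN in c.
apply: cvg_trans c; apply: near_eq_cvg.
by near=> n; rewrite (near (e i) n).
Unshelve. all: by end_near. Qed.

(** * The root, the unique bounded solution and the limit of the truncations *)

Unset Implicit Arguments.

Theorem mainTheorem3 (R : realType) :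
  exists rho1 : R,
    [/\ is_pos_root rho1,
        (forall r : R, is_pos_root r -> r = rho1),
        `|rho1 - 456%:R / 1000%:R| <= 2000%:R^-1 &
        forall rho : R, 0 < rho -> rho < rho1 ->
          exists (w : nat -> R) (wN : forall N : nat, 'cV[R]_N),
            [/\ unique (bounded_solution rho) w,
                (forall N : nat, (1 <= N)%N ->
                   unique (@trunc_solution R rho N) (wN N)) &
                (forall k : nat,
                   cauchy (trunc_seq wN k @ \oo) /\
                   trunc_seq wN k @ \oo --> w k)]].
Proof.
have [rho1 root1] := @pos_root_exists R.
have /andP[lo hi] := pos_root_bounds root1.
exists rho1; split=> //.
- by move=> r rootr; exact: pos_root_unique.
- by rewrite ler_distl; apply/andP; split; lra.
move=> rho r0 rlt; have r1 : rho <= 913 / 2000 by exact: le_trans (ltW rlt) hi.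
have dom := kernel_dominated r0 r1.
pose wN N : 'cV[R]_N := invmx (trunc_mx rho N) *m trunc_rhs R N.
have wNsol N : trunc_solution rho (wN N).
  by rewrite /trunc_solution mulKVmx// trunc_mx_unit.
have bd i : `|unit_rhs i| <= 1 * weight i :> R.
  rewrite mul1r; have /andP[w1 _] := @weight_bounds R i.
  by apply: le_trans w1; rewrite /unit_rhs; case: eqP; rewrite ?normr1 ?normr0.
have [w [wb ws wc]] :=
  truncated_solution_cvg dom ler01 bd (fun N => (trunc_solutionP _ r0).1 (wNsol N)).
have [/andP[_ /ltW q1] _ _ _ _] := dom.
have wbd : bounded_fun w.
  apply/bounded_funP_nat; exists (1 / (1 - 199 / 200) * 3) => i.
  apply: le_trans (wb i) _; apply: ler_wpM2l; first by rewrite mul1r invr_ge0 subr_ge0.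
  by have /andP[] := @weight_bounds R i.
exists w, wN; split.
- split=> [|w' [/bounded_funP_nat[M hM] /solves_systemP -/(_ r0) ws']].
    by split => //; apply/solves_systemP.
  (* The difference of two bounded solutions solves the homogeneous problem, and a plain bound is a
     weighted one because the weights are at least 1. *)
  have /bounded_funP_nat[M' hM'] := wbd.
  apply/funext => i; apply/eqP; rewrite -subr_eq0; apply/eqP; move: i.
  apply: (row_dominated_unique (z := fun i => w i - w' i) (B := M' + M) dom).
    move=> i; apply: le_trans (ler_normB _ _) _.
    have M0 : 0 <= M' + M by rewrite addr_ge0//; [apply: le_trans (hM' 0%N)|apply: le_trans (hM 0%N)].
    have /andP[w1 _] := @weight_bounds R i.
    by apply: (@le_trans _ _ (M' + M)); [exact: lerD|rewrite ler_peMr].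
  move=> i.
  have -> : series (fun j => kernel rho i j * (w j - w' j)) =
     (fun n => series (fun j => kernel rho i j * w j) n -
               series (fun j => kernel rho i j * w' j) n).
    apply/funext => n; rewrite /series/= -sumrB.
    by apply: eq_bigr => j _; rewrite mulrBr.
  have -> : w i - w' i = (w i - unit_rhs i) - (w' i - unit_rhs i) by ring.
  by apply: cvgB; [exact: ws|exact: ws'].
- move=> N _; split=> // v sol.
  apply: (can_inj (mulKmx (trunc_mx_unit N r0 r1))).
  by rewrite sol wNsol.
- move=> k.
  have c : trunc_seq wN k @ \oo --> w k.
    (* [trunc_seq] starts at size k+1, so it is a shift of the sequence whose limit is known. *)
    have -> : trunc_seq wN k = (fun n => vec_seq (wN (n + k.+1)%N) k).
      apply/funext => n; rewrite /trunc_seq (addnC n).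
      by rewrite -(vec_seq_ord (wN _)).
    by have := wc k; rewrite -(cvg_shiftn k.+1).
  by split => //; apply: cvg_cauchy; apply/cvg_ex; exists (w k).
Qed.
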